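(* Let $G$ be a group (not necessarily finite) with two finite subgroups $H$ and $K$ satisfying $H\cap K=\{e\}$, and let $\Omega=\{(h,k)\in H\times K: hk\in KH\}$. Consider the algebras $C(\Omega)$ and $C(\widehat\Omega)$ described in the context with the coproducts $$\Delta(f)(u,v;h,k)=f(uh,k)\,\delta_{h\triangleright k}(v)\quad (f\in C(\Omega)),\qquad \Delta(g)(u,v;h,k)=g(u,vk)\,\delta_{u\triangleleft v}(h)\quad (g\in C(\widehat\Omega)),$$ where $(u,v),(h,k)\in\Omega$. Then these coproducts are algebra homomorphisms if and only if $HK=KH$.
   Context: For $(h,k)\in\Omega$ the elements $h\triangleright k\in K$ and $h\triangleleft k\in H$ are defined by $hk=(h\triangleright k)(h\triangleleft k)$ (well defined since $H\cap K=\{e\}$). $\delta$ is the Kronecker delta: $\delta_x(y)=1$ if $x=y$ and $0$ otherwise. $C(\Omega)$ is the space of complex functions on $\Omega$ with product $(f_1f_2)(h,k)=\sum_v f_1(h,v)f_2(h\triangleleft v,v^{-1}k)$, the sum over $v\in K$ with $(h,v)\in\Omega$. $C(\widehat\Omega)$ is the same space with product $(g_1g_2)(h,k)=\sum_u g_1(hu^{-1},u\triangleright k)g_2(u,k)$, the sum over $u\in H$ with $(u,k)\in\Omega$. Tensor squares are identified with functions on $\Omega\times\Omega$. The given coproducts are the ones induced by the pairing $\langle f,g\rangle=\sum_{(h,k)\in\Omega}f(h,k)g(h,k)$, i.e. $\langle\Delta(f),g\otimes g'\rangle=\langle f,gg'\rangle$ and $\langle f\otimes f',\Delta(g)\rangle=\langle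 ff',g\rangle$. *)

(* Defs.v *)
From HB Require Import structures.
From mathcomp Require Import all_boot all_order all_fingroup all_algebra.
From mathcomp Require Import finmap ring.
From mathcomp Require Import reals complex.

Set Implicit Arguments.
Unset Strict Implicit.
Unset Printing Implicit Defensive.

Import GRing.Theory.

Local Open Scope fset_scope.
Local Open Scope ring_scope.

(* Unital associative algebra structures on the space of functions T -> F,   *)
(* for a finite set T, carried as data so that the same space of functions   *)
(* can have several products.                                                *)
Record fun_alg (F : fieldType) (T : finType) := FunAlg {
  fa_mul : {ffun T -> F^o} -> {ffun T -> F^o} -> {ffun T -> F^o};
  fa_one : {ffun T -> F^o};
  fa_mulA : associative fa_mul;
  fa_mul1f : left_id fa_one fa_mul;
  fa_mulf1 : right_id fa_one fa_mul;
  fa_linl : forall g, linear (fa_mul ^~ g);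
  fa_linr : forall f, linear (fa_mul f);
  fa_one_neq0 : fa_one != 0
}.

Definition alg_of (F : fieldType) (T : finType) (a : fun_alg F T) : Type :=
  {ffun T -> F^o}.

Section AlgOf.
Variables (F : fieldType) (T : finType) (a : fun_alg F T).

HB.instance Definition _ := GRing.Lmodule.on (alg_of a).

Fact fa_mulDl : left_distributive (fa_mul a) +%R.
Proof. by move=> x y z; have := fa_linl a z 1 x y; rewrite !scale1r. Qed.

Fact fa_mulDr : right_distributive (fa_mul a) +%R.
Proof. by move=> x y z; have := fa_linr a x 1 y z; rewrite !scale1r. Qed.

Fact fa_mul0f g : fa_mul a 0 g = 0.
Proof. by apply: (addIr (fa_mul a 0 g)); rewrite -fa_mulDl !add0r. Qed.

Fact fa_mulf0 f : fa_mul a f 0 = 0.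
Proof. by apply: (addIr (fa_mul a f 0)); rewrite -fa_mulDr !add0r. Qed.

Fact fa_mulZl (c : F) f g : fa_mul a (c *: f) g = c *: fa_mul a f g.
Proof. by have := fa_linl a g c f 0; rewrite fa_mul0f !addr0. Qed.

Fact fa_mulZr (c : F) f g : fa_mul a f (c *: g) = c *: fa_mul a f g.
Proof. by have := fa_linr a f c g 0; rewrite fa_mulf0 !addr0. Qed.

Fact fa_suml I (r : seq I) (P : pred I) (E : I -> {ffun T -> F^o}) g :
  fa_mul a (\sum_(i <- r | P i) E i) g = \sum_(i <- r | P i) fa_mul a (E i) g.
Proof.
by apply: (big_morph (fa_mul a ^~ g)) => [x y|]; rewrite (fa_mulDl, fa_mul0f).
Qed.

Fact fa_sumr I (r : seq I) (P : pred I) (E : I -> {ffun T -> F^o}) f :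
  fa_mul a f (\sum_(i <- r | P i) E i) = \sum_(i <- r | P i) fa_mul a f (E i).
Proof.
by apply: (big_morph (fa_mul a f)) => [x y|]; rewrite (fa_mulDr, fa_mulf0).
Qed.

HB.instance Definition _ := GRing.Zmodule_isNzRing.Build (alg_of a)
  (fa_mulA a) (fa_mul1f a) (fa_mulf1 a) fa_mulDl fa_mulDr (fa_one_neq0 a).

Fact fa_scalerAl (c : F) (f g : alg_of a) : c *: (f * g) = (c *: f) * g.
Proof. by rewrite /GRing.mul /= fa_mulZl. Qed.

HB.instance Definition _ :=
  GRing.Lmodule_isLalgebra.Build F (alg_of a) fa_scalerAl.

Fact fa_scalerAr (c : F) (f g : alg_of a) : c *: (f * g) = f * (c *: g).
Proof. by rewrite /GRing.mul /= fa_mulZr. Qed.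

HB.instance Definition _ :=
  GRing.Lalgebra_isAlgebra.Build F (alg_of a) fa_scalerAr.

End AlgOf.

Definition alg_hom (F : fieldType) (A B : algType F) (f : A -> B) : Prop :=
  linear f /\ GRing.monoid_morphism f.

Definition delta (F : fieldType) (T : finType) (x : T) : {ffun T -> F^o} :=
  [ffun y => (x == y)%:R].

(* The identification of C(T) (x) C(U) with C(T x U).                        *)
Definition tens (F : fieldType) (T U : finType)
    (f : {ffun T -> F^o}) (g : {ffun U -> F^o}) : {ffun T * U -> F^o} :=
  [ffun p => f p.1 * g p.2].

Lemma delta_sum (F : fieldType) (T : finType) (f : {ffun T -> F^o}) :
  f = \sum_x f x *: delta F x.
Proof.
apply/ffunP => y; rewrite sum_ffunE (bigD1 y) //= big1 => [|x /negPf xy].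
  by rewrite !ffunE eqxx addr0 /GRing.scale /= mulr1.
by rewrite !ffunE xy /GRing.scale /= mulr0.
Qed.

(* The product of the tensor product algebra, expanded on the basis of the   *)
(* delta functions; tensMM says that it is (f (x) g)(f' (x) g') =            *)
(* ff' (x) gg' on elementary tensors.                                        *)
Section TensorProduct.
Variables (F : fieldType) (T U : finType) (a : fun_alg F T) (b : fun_alg F U).
Implicit Types (f : {ffun T -> F^o}) (g : {ffun U -> F^o}).
Implicit Types (X Y Z : {ffun T * U -> F^o}).

Definition tens_mul X Y : {ffun T * U -> F^o} :=
  \sum_p \sum_q (X p * Y q) *:
    tens (fa_mul a (delta F p.1) (delta F q.1))
         (fa_mul b (delta F p.2) (delta F q.2)).

Definition tens_one : {ffun T * U -> F^o} := tens (fa_one a) (fa_one b).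

Lemma tens_suml I (r : seq I) (P : pred I) (E : I -> {ffun T -> F^o}) g :
  tens (\sum_(i <- r | P i) E i) g = \sum_(i <- r | P i) tens (E i) g.
Proof.
apply/ffunP => p; rewrite sum_ffunE ffunE sum_ffunE mulr_suml.
by apply: eq_bigr => i _; rewrite ffunE.
Qed.

Lemma tens_sumr I (r : seq I) (P : pred I) (E : I -> {ffun U -> F^o}) f :
  tens f (\sum_(i <- r | P i) E i) = \sum_(i <- r | P i) tens f (E i).
Proof.
apply/ffunP => p; rewrite sum_ffunE ffunE sum_ffunE mulr_sumr.
by apply: eq_bigr => i _; rewrite ffunE.
Qed.

Lemma tensZl c f g : tens (c *: f) g = c *: tens f g.
Proof. by apply/ffunP => p; rewrite !ffunE /GRing.scale /= mulrA. Qed.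

Lemma tensZr c f g : tens f (c *: g) = c *: tens f g.
Proof. by apply/ffunP => p; rewrite !ffunE /GRing.scale /= mulrCA. Qed.

Lemma tens_delta_sum X : X = \sum_p X p *: tens (delta F p.1) (delta F p.2).
Proof.
rewrite {1}[X]delta_sum; apply: eq_bigr => p _; congr (_ *: _).
apply/ffunP => q; rewrite !ffunE -natrM mulnb.
by case: p q => [p1 p2] [q1 q2]; rewrite xpair_eqE.
Qed.

Lemma tens_linl Y : linear (tens_mul ^~ Y).
Proof.
move=> c X X'; rewrite /tens_mul scaler_sumr -big_split; apply: eq_bigr => p _.
rewrite scaler_sumr -big_split; apply: eq_bigr => q _ /=.
by rewrite !ffunE scalerA -scalerDl mulrA -mulrDl.
Qed.

Lemma tens_linr X : linear (tens_mul X).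
Proof.
move=> c Y Y'; rewrite /tens_mul scaler_sumr -big_split; apply: eq_bigr => p _.
rewrite scaler_sumr -big_split; apply: eq_bigr => q _ /=.
by rewrite !ffunE scalerA -scalerDl mulrCA -mulrDr.
Qed.

Lemma tensMM f g f' g' :
  tens_mul (tens f g) (tens f' g') = tens (fa_mul a f f') (fa_mul b g g').
Proof.
pose E x y z w := tens (fa_mul a (f x *: delta F x) (f' z *: delta F z))
                       (fa_mul b (g y *: delta F y) (g' w *: delta F w)).
transitivity (\sum_p \sum_q E p.1 p.2 q.1 q.2).
  apply: eq_bigr => p _; apply: eq_bigr => q _; rewrite /E !ffunE.
  rewrite !fa_mulZl !fa_mulZr !(tensZl, tensZr) !scalerA.
  by congr (_ *: _); ring.
rewrite -(pair_bigA _ (fun x y => \sum_q E x y q.1 q.2)) /=.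
rewrite [f in RHS]delta_sum [g in RHS]delta_sum fa_suml tens_suml.
apply: eq_bigr => x _; rewrite fa_suml tens_sumr; apply: eq_bigr => y _.
rewrite -(pair_bigA _ (E x y)) /=.
rewrite [f' in RHS]delta_sum [g' in RHS]delta_sum fa_sumr tens_suml.
by apply: eq_bigr => z _; rewrite fa_sumr tens_sumr.
Qed.

End TensorProduct.

Section TensorAlgebra.
Variables (F : fieldType) (T U : finType) (a : fun_alg F T) (b : fun_alg F U).

Lemma tens_mulDl X Y Z :
  tens_mul a b (X + Y) Z = tens_mul a b X Z + tens_mul a b Y Z.
Proof. by have := tens_linl a b Z 1 X Y; rewrite !scale1r. Qed.

Lemma tens_mulDr X Y Z :
  tens_mul a b X (Y + Z) = tens_mul a b X Y + tens_mul a b X Z.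
Proof. by have := tens_linr a b X 1 Y Z; rewrite !scale1r. Qed.

Lemma tens_mul0l Y : tens_mul a b 0 Y = 0.
Proof. by apply: (addIr (tens_mul a b 0 Y)); rewrite -tens_mulDl !add0r. Qed.

Lemma tens_mul0r Y : tens_mul a b Y 0 = 0.
Proof. by apply: (addIr (tens_mul a b Y 0)); rewrite -tens_mulDr !add0r. Qed.

Lemma tens_mulZl c X Y : tens_mul a b (c *: X) Y = c *: tens_mul a b X Y.
Proof. by have := tens_linl a b Y c X 0; rewrite tens_mul0l !addr0. Qed.

Lemma tens_mulZr c X Y : tens_mul a b X (c *: Y) = c *: tens_mul a b X Y.
Proof. by have := tens_linr a b X c Y 0; rewrite tens_mul0r !addr0. Qed.

Lemma tens_mul_suml I (r : seq I) (P : pred I) E Y :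
  tens_mul a b (\sum_(i <- r | P i) E i) Y
  = \sum_(i <- r | P i) tens_mul a b (E i) Y.
Proof.
by apply: (big_morph (tens_mul a b ^~ Y)) => [x y|];
  rewrite (tens_mulDl, tens_mul0l).
Qed.

Lemma tens_mul_sumr I (r : seq I) (P : pred I) E X :
  tens_mul a b X (\sum_(i <- r | P i) E i)
  = \sum_(i <- r | P i) tens_mul a b X (E i).
Proof.
by apply: (big_morph (tens_mul a b X)) => [x y|];
  rewrite (tens_mulDr, tens_mul0r).
Qed.

Lemma tens_ind (P : {ffun T * U -> F^o} -> Prop) :
    P 0 -> (forall X Y, P X -> P Y -> P (X + Y)) ->
    (forall c X, P X -> P (c *: X)) -> (forall f g, P (tens f g)) ->
  forall X, P X.
Proof.
move=> P0 PD PZ Pt X; rewrite [X]tens_delta_sum.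
by apply: big_ind => // p _; exact/PZ/Pt.
Qed.

Lemma tens_mulA : associative (tens_mul a b).
Proof.
move=> X Y Z; elim/tens_ind: X => [|X X' IH IH'|c X IH|f g].
- by rewrite !tens_mul0l.
- by rewrite !tens_mulDl IH IH'.
- by rewrite !tens_mulZl IH.
elim/tens_ind: Y => [|Y Y' IH IH'|c Y IH|f' g'].
- by rewrite !(tens_mul0l, tens_mul0r).
- by rewrite !(tens_mulDl, tens_mulDr) IH IH'.
- by rewrite !(tens_mulZl, tens_mulZr) IH.
elim/tens_ind: Z => [|Z Z' IH IH'|c Z IH|f'' g''].
- by rewrite !tens_mul0r.
- by rewrite !tens_mulDr IH IH'.
- by rewrite !tens_mulZr IH.
by rewrite !tensMM !fa_mulA.
Qed.

Lemma tens_mul1l : left_id (tens_one a b) (tens_mul a b).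
Proof.
move=> X; elim/tens_ind: X => [|X X' IH IH'|c X IH|f g].
- by rewrite tens_mul0r.
- by rewrite tens_mulDr IH IH'.
- by rewrite tens_mulZr IH.
by rewrite tensMM !fa_mul1f.
Qed.

Lemma tens_mul1r : right_id (tens_one a b) (tens_mul a b).
Proof.
move=> X; elim/tens_ind: X => [|X X' IH IH'|c X IH|f g].
- by rewrite tens_mul0l.
- by rewrite tens_mulDl IH IH'.
- by rewrite tens_mulZl IH.
by rewrite tensMM !fa_mulf1.
Qed.

Lemma tens_one_neq0 : tens_one a b != 0.
Proof.
have nz V (c : fun_alg F V) : exists x, fa_one c x != 0.
  apply/existsP; apply: contraT; rewrite negb_exists => /forallP c0.
  case/eqP: (fa_one_neq0 c); apply/ffunP => x; rewrite ffunE.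
  exact/eqP/negPn/c0.
have [x ax] := nz _ a; have [y by0] := nz _ b.
apply/eqP => /ffunP /(_ (x, y)); rewrite !ffunE /= => /eqP.
by rewrite mulf_eq0 (negPf ax) (negPf by0).
Qed.

Definition tens_alg : fun_alg F (T * U)%type :=
  FunAlg tens_mulA tens_mul1l tens_mul1r
    (tens_linl a b) (tens_linr a b) tens_one_neq0.

End TensorAlgebra.

Section Omega.
Variables (G : groupType) (H K : {fset G}).

Definition fset_mulg (A B : {fset G}) : {fset G} :=
  [fset (x * y)%g | x in A, y in B].

Definition Omega : {fset G * G} :=
  [fset p in H `*` K | (p.1 * p.2)%g \in fset_mulg K H].

(* A factorization x = p.1 p.2 with p.1 in K and p.2 in H; (1, 1) if there   *)
(* is none.                                                                  *)
Definition KH_factor (x : G) : G * G :=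
  head (1%g, 1%g) [seq p <- (K `*` H)%fset | (p.1 * p.2)%g == x].

Definition lact (h k : G) : G := (KH_factor (h * k)%g).1.
Definition ract (h k : G) : G := (KH_factor (h * k)%g).2.

Definition ev (F : fieldType) (f : {ffun Omega -> F^o}) (h k : G) : F :=
  if insub (h, k) is Some p then f p else 0.

End Omega.

(* In conv and conv_hat the arguments of ev always lie in Omega (see         *)
(* Omega_conv and Omega_convh), so the zero extension plays no role. In the  *)
(* coproducts this holds whenever the Kronecker delta is 1 (see Omega_cop    *)
(* and Omega_coph).                                                          *)
Section Products.
Variables (G : groupType) (H K : {fset G}) (F : fieldType).
Notation Omega := (Omega H K).
Notation "h ▷ k" := (lact H K h k) (at level 40).
Notation "h ◁ k" := (ract H K h k) (at level 40).

Definition conv (f1 f2 : {ffun Omega -> F^o}) : {ffun Omega -> F^o} :=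
  [ffun p : Omega => let: (h, k) := val p in
    \sum_(v <- K | (h, v) \in Omega)
      ev f1 h v * ev f2 (h ◁ v) (v^-1 * k)%g].

Definition conv_one : {ffun Omega -> F^o} :=
  [ffun p : Omega => ((val p).2 == 1%g)%:R].

Definition conv_hat (g1 g2 : {ffun Omega -> F^o}) : {ffun Omega -> F^o} :=
  [ffun p : Omega => let: (h, k) := val p in
    \sum_(u <- H | (u, k) \in Omega)
      ev g1 (h * u^-1)%g (u ▷ k) * ev g2 u k].

Definition conv_hat_one : {ffun Omega -> F^o} :=
  [ffun p : Omega => ((val p).1 == 1%g)%:R].

Definition coproduct (f : {ffun Omega -> F^o}) : {ffun Omega * Omega -> F^o} :=
  [ffun q : Omega * Omega =>
    let: (u, v) := val q.1 in let: (h, k) := val q.2 in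
    ev f (u * h)%g k * (h ▷ k == v)%:R].

Definition coproduct_hat (g : {ffun Omega -> F^o}) : {ffun Omega * Omega -> F^o} :=
  [ffun q : Omega * Omega =>
    let: (u, v) := val q.1 in let: (h, k) := val q.2 in
    ev g u (v * k)%g * (u ◁ v == h)%:R].

Hypothesis gH : group_closed [in H].
Hypothesis gK : group_closed [in K].
Hypothesis tHK : H `&` K = [fset 1%g].

Let H1 : 1%g \in H. Proof. by case: gH. Qed.
Let K1 : 1%g \in K. Proof. by case: gK. Qed.
Let HV x : x \in H -> (x^-1)%g \in H. Proof. exact: group_closedV. Qed.
Let KV x : x \in K -> (x^-1)%g \in K. Proof. exact: group_closedV. Qed.
Let HM x y : x \in H -> y \in H -> (x * y)%g \in H.
Proof. exact: group_closedM. Qed.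
Let KM x y : x \in K -> y \in K -> (x * y)%g \in K.
Proof. exact: group_closedM. Qed.

Lemma fset_mulgP (A B : {fset G}) x :
  reflect (exists a b, [/\ a \in A, b \in B & x = (a * b)%g])
          (x \in fset_mulg A B).
Proof.
apply: (iffP idP) => [/imfset2P [a aA [b bB ->]]|[a [b [aA bB ->]]]].
  by exists a, b.
by apply/imfset2P; exists a => //; exists b.
Qed.

Lemma KH_factorE a b : a \in K -> b \in H -> KH_factor H K (a * b)%g = (a, b).
Proof.
move=> aK bH; rewrite /KH_factor.
set s := [seq _ <- _ | _].
have ab_s : (a, b) \in s by rewrite mem_filter eqxx in_fsetM aK bH.
have : head (1%g, 1%g) s \in s by case: s ab_s => // p s _; rewrite mem_head.
case: (head _ s) => c d; rewrite mem_filter in_fsetM /=.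
case/andP => /eqP cd /andP[cK dH].
have e1 : (a^-1 * c)%g = 1%g.
  apply/fset1P; rewrite -tHK in_fsetI (KM (KV aK) cK) andbT.
  suff -> : (a^-1 * c)%g = (b * d^-1)%g by rewrite HM ?HV.
  by apply: (mulIg d); rewrite -mulgA cd mulgVK mulKg.
have -> : c = a by rewrite -[RHS]mulg1 -e1 mulKVg.
congr (_, _).
move: cd; rewrite -[c](mulKVg a) e1 mulg1; exact: mulgI.
Qed.

Lemma OmegaE h k :
  ((h, k) \in Omega) = [&& h \in H, k \in K & (h * k)%g \in fset_mulg K H].
Proof. by rewrite !inE /= -andbA. Qed.

Lemma lract_uniq h k a b : a \in K -> b \in H -> (h * k = a * b)%g ->
  h ▷ k = a /\ h ◁ k = b.
Proof. by move=> aK bH e; rewrite /lact /ract e KH_factorE. Qed.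

Lemma OmegaP h k : (h, k) \in Omega ->
  [/\ h \in H, k \in K, h ▷ k \in K, h ◁ k \in H & (h * k = (h ▷ k) * (h ◁ k))%g].
Proof.
rewrite OmegaE => /and3P[hH kK /fset_mulgP[a [b [aK bH e]]]].
by have [-> ->] := lract_uniq aK bH e.
Qed.

Lemma OmegaI h k a b : h \in H -> k \in K -> a \in K -> b \in H ->
  (h * k = a * b)%g -> (h, k) \in Omega.
Proof.
by move=> hH kK aK bH e; rewrite OmegaE hH kK; apply/fset_mulgP; exists a, b.
Qed.

Lemma Omega1l k : k \in K -> (1%g, k) \in Omega.
Proof. by move=> kK; apply: (OmegaI H1 kK kK H1); rewrite mul1g mulg1. Qed.

Lemma Omega1r h : h \in H -> (h, 1%g) \in Omega.
Proof. by move=> hH; apply: (OmegaI hH K1 K1 hH); rewrite mul1g mulg1. Qed.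

Lemma lact1 h : h \in H -> h ▷ 1%g = 1%g.
Proof.
by move=> hH; case: (@lract_uniq h 1%g 1%g h) => //; rewrite mul1g mulg1.
Qed.

Lemma ract1 h : h \in H -> h ◁ 1%g = h.
Proof.
by move=> hH; case: (@lract_uniq h 1%g 1%g h) => //; rewrite mul1g mulg1.
Qed.

Lemma lact1l k : k \in K -> 1%g ▷ k = k.
Proof.
by move=> kK; case: (@lract_uniq 1%g k k 1%g) => //; rewrite mul1g mulg1.
Qed.

Lemma ract1l k : k \in K -> 1%g ◁ k = 1%g.
Proof.
by move=> kK; case: (@lract_uniq 1%g k k 1%g) => //; rewrite mul1g mulg1.
Qed.

Lemma Omega_conv h v z : (h, v) \in Omega -> (h, z) \in Omega ->
  [/\ (h ◁ v, (v^-1 * z)%g) \in Omega, (h ◁ v) ◁ (v^-1 * z)%g = h ◁ z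
    & (h ◁ v) ▷ (v^-1 * z)%g = ((h ▷ v)^-1 * (h ▷ z))%g].
Proof.
case/OmegaP => hH vK aK bH e /OmegaP[_ zK cK dH e'].
have E : ((h ◁ v) * (v^-1 * z) = ((h ▷ v)^-1 * (h ▷ z)) * (h ◁ z))%g.
  rewrite -mulgA -e'; apply: (mulgI (h ▷ v)).
  by rewrite mulgA -e mulgA mulgK mulKVg.
have K1' : (v^-1 * z)%g \in K by rewrite KM ?KV.
have K2' : ((h ▷ v)^-1 * (h ▷ z))%g \in K by rewrite KM ?KV.
split; [exact: (OmegaI bH K1' K2' dH E) | |]; by case: (lract_uniq K2' dH E).
Qed.

Lemma Omega_convV h v z : z \in K -> (h, v) \in Omega ->
  (h ◁ v, (v^-1 * z)%g) \in Omega = ((h, z) \in Omega).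
Proof.
move=> zK hv; apply/idP/idP; last by move=> hz; case: (Omega_conv hv hz).
case/OmegaP: hv => hH vK aK bH e.
case/OmegaP => _ _ cK dH e'; apply: (OmegaI hH zK (KM aK cK) dH).
by rewrite -mulgA -e' mulgA -e mulgA mulgK.
Qed.

Lemma Omega_convh u z k : (u, k) \in Omega -> (z, k) \in Omega ->
  [/\ ((z * u^-1)%g, u ▷ k) \in Omega, (z * u^-1)%g ▷ (u ▷ k) = z ▷ k
    & (z * u^-1)%g ◁ (u ▷ k) = ((z ◁ k) * (u ◁ k)^-1)%g].
Proof.
case/OmegaP => uH kK aK bH e /OmegaP[zH _ cK dH e'].
have E : ((z * u^-1) * (u ▷ k) = (z ▷ k) * ((z ◁ k) * (u ◁ k)^-1))%g.
  rewrite [RHS]mulgA -e'; apply: (mulIg (u ◁ k)).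
  by rewrite mulgVK -mulgA -e mulgA mulgVK.
have H1' : (z * u^-1)%g \in H by rewrite HM ?HV.
have H2' : ((z ◁ k) * (u ◁ k)^-1)%g \in H by rewrite HM ?HV.
split; [exact: (OmegaI H1' aK cK H2' E) | |]; by case: (lract_uniq cK H2' E).
Qed.

Lemma Omega_convhV u z k : z \in H -> (u, k) \in Omega ->
  ((z * u^-1)%g, u ▷ k) \in Omega = ((z, k) \in Omega).
Proof.
move=> zH uk; apply/idP/idP; last by move=> zk; case: (Omega_convh uk zk).
case/OmegaP: uk => uH kK aK bH e.
case/OmegaP => _ _ cK dH e'; apply: (OmegaI zH kK cK (HM dH bH)).
by rewrite mulgA -e' -mulgA -e mulgA mulgVK.
Qed.

Lemma Omega_cop u h k : (u, h ▷ k) \in Omega -> (h, k) \in Omega ->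
  ((u * h)%g, k) \in Omega.
Proof.
case/OmegaP => uH _ aK bH e /OmegaP[hH kK _ dH e'].
by apply: (OmegaI (HM uH hH) kK aK (HM bH dH)); rewrite mulgA -e -!mulgA e'.
Qed.

Lemma Omega_coph u v k : (u, v) \in Omega -> (u ◁ v, k) \in Omega ->
  (u, (v * k)%g) \in Omega.
Proof.
case/OmegaP => uH vK aK _ e /OmegaP[_ kK cK dH e'].
by apply: (OmegaI uH (KM vK kK) (KM aK cK) dH); rewrite mulgA e -!mulgA e'.
Qed.

Lemma evE (f : {ffun Omega -> F^o}) (p : Omega) : ev f (val p).1 (val p).2 = f p.
Proof. by rewrite /ev -surjective_pairing valK. Qed.

Lemma ev_in (f : {ffun Omega -> F^o}) h k (hk : (h, k) \in Omega) :
  ev f h k = f [` hk].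
Proof. by rewrite -evE. Qed.

Lemma conv_oneE h k : (h, k) \in Omega -> ev conv_one h k = (k == 1%g)%:R.
Proof. by move=> hk; rewrite (ev_in _ hk) ffunE. Qed.

Lemma conv_hat_oneE h k : (h, k) \in Omega -> ev conv_hat_one h k = (h == 1%g)%:R.
Proof. by move=> hk; rewrite (ev_in _ hk) ffunE. Qed.

Lemma ev_lin c (f g : {ffun Omega -> F^o}) h k :
  ev (c *: f + g) h k = c * ev f h k + ev g h k.
Proof. by rewrite /ev; case: insub => [p|]; rewrite ?ffunE // mulr0 addr0. Qed.

Lemma sum_Kshift a (P : pred G) (E : G -> F) : a \in K ->
  \sum_(x <- K | P x) E x = \sum_(x <- K | P (a * x)%g) E (a * x)%g.
Proof.
move=> aK; rewrite -(big_map (fun x => (a * x)%g) P E); apply: perm_big.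
apply: uniq_perm; rewrite ?(map_inj_uniq (mulgI a)) ?fset_uniq // => x.
apply/idP/mapP => [xK|[y yK ->]]; last exact: KM.
by exists (a^-1 * x)%g; rewrite ?mulKVg // KM ?KV.
Qed.

Lemma sum_Hshift a (P : pred G) (E : G -> F) : a \in H ->
  \sum_(x <- H | P x) E x = \sum_(x <- H | P (x * a)%g) E (x * a)%g.
Proof.
move=> aK; rewrite -(big_map (fun x => (x * a)%g) P E); apply: perm_big.
apply: uniq_perm; rewrite ?(map_inj_uniq (mulIg a)) ?fset_uniq // => x.
apply/idP/mapP => [xK|[y yK ->]]; last exact: HM.
by exists (x * a^-1)%g; rewrite ?mulgVK // HM ?HV.
Qed.

Lemma conv_evE f1 f2 h k : (h, k) \in Omega -> ev (conv f1 f2) h k =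
  \sum_(v <- K | (h, v) \in Omega) ev f1 h v * ev f2 (h ◁ v) (v^-1 * k)%g.
Proof. by move=> hk; rewrite (ev_in _ hk) ffunE. Qed.

Lemma convh_evE f1 f2 h k : (h, k) \in Omega -> ev (conv_hat f1 f2) h k =
  \sum_(u <- H | (u, k) \in Omega) ev f1 (h * u^-1)%g (u ▷ k) * ev f2 u k.
Proof. by move=> hk; rewrite (ev_in _ hk) ffunE. Qed.

Lemma ev_inj (f g : {ffun Omega -> F^o}) :
  (forall h k, (h, k) \in Omega -> ev f h k = ev g h k) -> f = g.
Proof.
move=> fg; apply/ffunP => p; rewrite -!evE; apply: fg.
by rewrite -surjective_pairing (valP p).
Qed.

Lemma convA : associative conv.
Proof.
move=> f1 f2 f3; apply: ev_inj => h k hk; rewrite !conv_evE //.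
have [hH kK _ _ _] := OmegaP hk.
transitivity (\sum_(v <- K | (h, v) \in Omega) \sum_(z <- K | (h, z) \in Omega)
  ev f1 h v * ev f2 (h ◁ v) (v^-1 * z)%g * ev f3 (h ◁ z) (z^-1 * k)%g).
  apply: eq_bigr => v hv; have [_ vK aK bH e] := OmegaP hv.
  have [o _ _] := Omega_conv hv hk.
  rewrite conv_evE // mulr_sumr (sum_Kshift _ _ (KV vK)).
  rewrite [LHS]big_seq_cond [RHS]big_seq_cond; apply: eq_big => [z|z /andP[zK hvz]].
    by case zK: (z \in K); rewrite //= Omega_convV.
  have hz : (h, z) \in Omega by rewrite -(Omega_convV zK hv).
  have [_ -> _] := Omega_conv hv hz.
  by rewrite mulrA invgM invgK -mulgA mulKVg.
rewrite exchange_big /=; apply: eq_bigr => z hz.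
by rewrite conv_evE // mulr_suml.
Qed.

Lemma convhA : associative conv_hat.
Proof.
move=> f1 f2 f3; apply: ev_inj => h k hk; rewrite !convh_evE //.
have [hH kK _ _ _] := OmegaP hk.
transitivity (\sum_(z <- H | (z, k) \in Omega) \sum_(u <- H | (u, k) \in Omega)
  ev f1 (h * z^-1)%g (z ▷ k) * ev f2 (z * u^-1)%g (u ▷ k) * ev f3 u k).
  apply: eq_bigr => z zk; rewrite convh_evE // mulr_sumr.
  by apply: eq_bigr => u _; rewrite mulrA.
rewrite exchange_big /=; apply: eq_bigr => u uk.
have [uH _ aK bH e] := OmegaP uk; have [o _ _] := Omega_convh uk hk.
rewrite convh_evE // mulr_suml [RHS](sum_Hshift _ _ (HV uH)).
rewrite [LHS]big_seq_cond [RHS]big_seq_cond; apply: eq_big => [z|z /andP[zH zk]].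
  by case zH: (z \in H); rewrite //= Omega_convhV.
have [_ -> _] := Omega_convh uk zk.
by rewrite invgM invgK mulgA mulgVK.
Qed.

Lemma conv1f : left_id conv_one conv.
Proof.
move=> f; apply: ev_inj => h k hk; rewrite conv_evE //.
have [hH kK _ _ _] := OmegaP hk; have o1 := Omega1r hH.
rewrite big_mkcond (big_fsetD1 1%g) //= o1 conv_oneE //= eqxx mul1r ract1 // invg1 mul1g.
rewrite big_seq big1 ?addr0 // => v /fsetD1P[/negPf v1 _]; case: ifP => // hv.
by rewrite conv_oneE //= v1 mul0r.
Qed.

Lemma convf1 : right_id conv_one conv.
Proof.
move=> f; apply: ev_inj => h k hk; rewrite conv_evE //.
have [hH kK _ bH _] := OmegaP hk.
rewrite big_mkcond (big_fsetD1 k) //= hk mulVg conv_oneE ?Omega1r //= eqxx mulr1.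
rewrite big_seq big1 ?addr0 // => v /fsetD1P[/negPf v1 _]; case: ifP => // hv.
have [o _ _] := Omega_conv hv hk.
by rewrite conv_oneE //= -(inj_eq (mulgI v)) mulKVg mulg1 eq_sym v1 mulr0.
Qed.

Lemma convhf1 : right_id conv_hat_one conv_hat.
Proof.
move=> f; apply: ev_inj => h k hk; rewrite convh_evE //.
have [hH kK _ _ _] := OmegaP hk; have o1 := Omega1l kK.
rewrite big_mkcond (big_fsetD1 1%g) //= o1 conv_hat_oneE //= eqxx mulr1 lact1l // invg1 mulg1.
rewrite big_seq big1 ?addr0 // => v /fsetD1P[/negPf v1 _]; case: ifP => // hv.
by rewrite conv_hat_oneE //= v1 mulr0.
Qed.

Lemma convh1f : left_id conv_hat_one conv_hat.
Proof.
move=> f; apply: ev_inj => h k hk; rewrite convh_evE //.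
have [hH kK aK _ _] := OmegaP hk.
rewrite big_mkcond (big_fsetD1 h) //= hk mulgV conv_hat_oneE ?Omega1l //= eqxx mul1r.
rewrite big_seq big1 ?addr0 // => v /fsetD1P[/negPf v1 _]; case: ifP => // hv.
have [o _ _] := Omega_convh hv hk.
by rewrite conv_hat_oneE //= -(inj_eq (mulIg v)) mulgVK mul1g eq_sym v1 mul0r.
Qed.

Lemma conv_linl g : linear (conv ^~ g).
Proof.
move=> c f f'; apply: ev_inj => h k hk; rewrite ev_lin !conv_evE // mulr_sumr.
by rewrite -big_split; apply: eq_bigr => v _; rewrite ev_lin mulrDl mulrA.
Qed.

Lemma conv_linr f : linear (conv f).
Proof.
move=> c g g'; apply: ev_inj => h k hk; rewrite ev_lin !conv_evE // mulr_sumr.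
by rewrite -big_split; apply: eq_bigr => v _; rewrite ev_lin mulrDr mulrCA.
Qed.

Lemma convh_linl g : linear (conv_hat ^~ g).
Proof.
move=> c f f'; apply: ev_inj => h k hk; rewrite ev_lin !convh_evE // mulr_sumr.
by rewrite -big_split; apply: eq_bigr => v _; rewrite ev_lin mulrDl mulrA.
Qed.

Lemma convh_linr f : linear (conv_hat f).
Proof.
move=> c g g'; apply: ev_inj => h k hk; rewrite ev_lin !convh_evE // mulr_sumr.
by rewrite -big_split; apply: eq_bigr => v _; rewrite ev_lin mulrDr mulrCA.
Qed.

Lemma conv_one_neq0 : conv_one != 0.
Proof.
apply/eqP => /ffunP /(_ [` Omega1r H1]); rewrite !ffunE /= eqxx => /eqP.
by rewrite oner_eq0.
Qed.

Lemma conv_hat_one_neq0 : conv_hat_one != 0.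
Proof.
apply/eqP => /ffunP /(_ [` Omega1r H1]); rewrite !ffunE /= eqxx => /eqP.
by rewrite oner_eq0.
Qed.

Definition Omega_alg : fun_alg F Omega :=
  FunAlg convA conv1f convf1 conv_linl conv_linr conv_one_neq0.

Definition Omega_hat_alg : fun_alg F Omega :=
  FunAlg convhA convh1f convhf1 convh_linl convh_linr conv_hat_one_neq0.

End Products.

(* Main.v *)
Require Import Defs.
From mathcomp Require Import all_boot all_order all_fingroup all_algebra.
From mathcomp Require Import finmap reals complex.

(** For [(u, v)] and [(h, k)] in Omega with [v = h ▷ k], both [Δ(f f')] and
    [Δ(f) Δ(f')] take at [(u, v; h, k)] the value
    [\sum_l f(uh, l) f'(uh ◁ l, l^-1 k)], where [l] ranges over the elements of
    [K] with [(uh, l)] in Omega for the former, and with the extra condition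
    that [(h, l)] is in Omega for the latter; everywhere else both vanish.
    When [HK = KH] Omega is all of [H * K] and the two sums agree; the dual
    coproduct is treated in the same way.  Conversely, at [u = h^-1],
    [v = k = 1], with [f] and [f'] the delta functions of [(1, l)] and
    [(1, l^-1)], the first sum is nonzero, and the second can only be so if
    [(h, l)] is in Omega.  Hence [HK] is contained in [KH], and taking inverses
    gives equality. *)

Local Open Scope fset_scope.
Local Open Scope ring_scope.

Import GRing.Theory.

(** Elementary tensors span, so a bilinear form is determined by its values on them. This gives
    closed formulas for [tens_mul], which is defined only by expansion on delta functions. *)
Lemma tens_mul_bilinE (F : fieldType) (T U : finType)
    (a : fun_alg F T) (b : fun_alg F U) (q : T * U)
    (B : {ffun T * U -> F^o} -> {ffun T * U -> F^o} -> F) :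
    (forall c X X' Y, B (c *: X + X') Y = c * B X Y + B X' Y) ->
    (forall c X Y Y', B X (c *: Y + Y') = c * B X Y + B X Y') ->
    (forall f g f' g', B (tens f g) (tens f' g') =
       tens (fa_mul a f f') (fa_mul b g g') q) ->
  forall X Y, tens_mul a b X Y q = B X Y.
Proof.
move=> Bl Br Bt.
have B0l Y : B 0 Y = 0.
  by apply: (addIr (B 0 Y)); rewrite -{1}(mul1r (B 0 Y)) -Bl scaler0 !add0r.
have B0r X : B X 0 = 0.
  by apply: (addIr (B X 0)); rewrite -{1}(mul1r (B X 0)) -Br scaler0 !add0r.
move=> X Y; elim/tens_ind: X => [|X X' IH IH'|c X IH|f g].
- by rewrite tens_mul0l ffunE B0l.
- by rewrite tens_mulDl ffunE IH IH' -[X in X + X']scale1r Bl mul1r.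
- by rewrite tens_mulZl ffunE IH -[c *: X]addr0 Bl B0l addr0.
elim/tens_ind: Y => [|Y Y' IH IH'|c Y IH|f' g'].
- by rewrite tens_mul0r ffunE B0r.
- by rewrite tens_mulDr ffunE IH IH' -[Y in Y + Y']scale1r Br mul1r.
- by rewrite tens_mulZr ffunE IH -[c *: Y]addr0 Br B0r addr0.
by rewrite tensMM Bt.
Qed.

Section Coproducts.
Context {G : groupType} {H K : {fset G}} {F : fieldType}.
Notation Omega := (Omega H K).
Notation "h ▷ k" := (lact H K h k) (at level 40).
Notation "h ◁ k" := (Defs.ract H K h k) (at level 40).
Notation fOmega := {ffun Omega -> F^o}.
Notation fOmega2 := {ffun Omega * Omega -> F^o}.

(** Extension by zero to four group elements, so that points such as [(u ◁ w, w^-1 v)] need no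
    membership proof. Nesting [ev] lets its linearity carry over. *)
Definition ev2 (X : fOmega2) (u v h k : G) : F :=
  ev [ffun p => ev [ffun q => X (p, q)] h k : F^o] u v.

Lemma ev2_in (X : fOmega2) u v h k
    (uv : (u, v) \in Omega) (hk : (h, k) \in Omega) :
  ev2 X u v h k = X ([` uv], [` hk]).
Proof. by rewrite /ev2 ev_in ffunE ev_in ffunE. Qed.

Lemma ev2_lin c (X Y : fOmega2) u v h k :
  ev2 (c *: X + Y) u v h k = c * ev2 X u v h k + ev2 Y u v h k.
Proof.
rewrite /ev2 -ev_lin; congr (ev _ u v); apply/ffunP => p.
by rewrite !ffunE -ev_lin; congr (ev _ h k); apply/ffunP => q; rewrite !ffunE.
Qed.

Lemma ev2_tens (f g : fOmega) u v h k :
  ev2 (tens f g) u v h k = ev f u v * ev g h k.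
Proof.
rewrite /ev2 /ev; case: (insubP _ (u, v)) => [p _ _|_]; last by rewrite mul0r.
rewrite ffunE; case: insubP => [q _ _|_]; last by rewrite mulr0.
by rewrite !ffunE.
Qed.

Lemma ev2_inj (X Y : fOmega2) :
    (forall u v h k, (u, v) \in Omega -> (h, k) \in Omega ->
       ev2 X u v h k = ev2 Y u v h k) ->
  X = Y.
Proof.
move=> XY; apply/ffunP => -[[[u v] uv] [[h k] hk]].
by have := XY u v h k uv hk; rewrite !ev2_in.
Qed.

Lemma coproductE (f : fOmega) u v h k :
    (u, v) \in Omega -> (h, k) \in Omega ->
  ev2 (coproduct f) u v h k = ev f (u * h)%g k * (h ▷ k == v)%:R.
Proof. by move=> uv hk; rewrite ev2_in ffunE. Qed.

Lemma coproduct_hatE (f : fOmega) u v h k :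
    (u, v) \in Omega -> (h, k) \in Omega ->
  ev2 (coproduct_hat f) u v h k = ev f u (v * k)%g * (u ◁ v == h)%:R.
Proof. by move=> uv hk; rewrite ev2_in ffunE. Qed.

Lemma coproduct_linear : linear (@coproduct G H K F).
Proof.
move=> c f g; apply: ev2_inj => u v h k uv hk.
by rewrite ev2_lin !coproductE // ev_lin mulrDl mulrA.
Qed.

Lemma coproduct_hat_linear : linear (@coproduct_hat G H K F).
Proof.
move=> c f g; apply: ev2_inj => u v h k uv hk.
by rewrite ev2_lin !coproduct_hatE // ev_lin mulrDl mulrA.
Qed.

Hypothesis gH : group_closed [in H].
Hypothesis gK : group_closed [in K].
Hypothesis tHK : H `&` K = [fset 1%g].
Notation A := (Omega_alg F gH gK tHK).
Notation A' := (Omega_hat_alg F gH gK tHK).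

(** * Explicit products in the tensor squares *)

(** The double sum is bilinear, and on elementary tensors it factors into two convolution sums. *)
Lemma tens_conv_evE (X Y : fOmega2) u v h k :
    (u, v) \in Omega -> (h, k) \in Omega ->
  ev2 (tens_mul A A X Y) u v h k =
  \sum_(w <- K | (u, w) \in Omega) \sum_(l <- K | (h, l) \in Omega)
    ev2 X u w h l * ev2 Y (u ◁ w) (w^-1 * v)%g (h ◁ l) (l^-1 * k)%g.
Proof.
move=> uv hk; rewrite ev2_in.
pose B X Y := \sum_(w <- K | (u, w) \in Omega) \sum_(l <- K | (h, l) \in Omega)
    ev2 X u w h l * ev2 Y (u ◁ w) (w^-1 * v)%g (h ◁ l) (l^-1 * k)%g.
apply: (@tens_mul_bilinE _ _ _ A A _ B).
- move=> c X1 X2 Z; rewrite /B mulr_sumr -big_split; apply: eq_bigr => w _ /=.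
  rewrite mulr_sumr -big_split; apply: eq_bigr => l _ /=.
  by rewrite ev2_lin mulrDl mulrA.
- move=> c Z X1 X2; rewrite /B mulr_sumr -big_split; apply: eq_bigr => w _ /=.
  rewrite mulr_sumr -big_split; apply: eq_bigr => l _ /=.
  by rewrite ev2_lin mulrDr mulrCA.
move=> f g f' g'; rewrite -(ev2_in _ _ _ _ _ uv hk) ev2_tens /= !conv_evE //.
rewrite /B mulr_suml; apply: eq_bigr => w _.
rewrite mulr_sumr; apply: eq_bigr => l _.
by rewrite !ev2_tens mulrACA.
Qed.

Lemma tens_conv_hat_evE (X Y : fOmega2) u v h k :
    (u, v) \in Omega -> (h, k) \in Omega ->
  ev2 (tens_mul A' A' X Y) u v h k =
  \sum_(w <- H | (w, v) \in Omega) \sum_(z <- H | (z, k) \in Omega)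
    ev2 X (u * w^-1)%g (w ▷ v) (h * z^-1)%g (z ▷ k) * ev2 Y w v z k.
Proof.
move=> uv hk; rewrite ev2_in.
pose B X Y := \sum_(w <- H | (w, v) \in Omega) \sum_(z <- H | (z, k) \in Omega)
    ev2 X (u * w^-1)%g (w ▷ v) (h * z^-1)%g (z ▷ k) * ev2 Y w v z k.
apply: (@tens_mul_bilinE _ _ _ A' A' _ B).
- move=> c X1 X2 Z; rewrite /B mulr_sumr -big_split; apply: eq_bigr => w _ /=.
  rewrite mulr_sumr -big_split; apply: eq_bigr => z _ /=.
  by rewrite ev2_lin mulrDl mulrA.
- move=> c Z X1 X2; rewrite /B mulr_sumr -big_split; apply: eq_bigr => w _ /=.
  rewrite mulr_sumr -big_split; apply: eq_bigr => z _ /=.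
  by rewrite ev2_lin mulrDr mulrCA.
move=> f g f' g'; rewrite -(ev2_in _ _ _ _ _ uv hk) ev2_tens /= !convh_evE //.
rewrite /B mulr_suml; apply: eq_bigr => w _.
rewrite mulr_sumr; apply: eq_bigr => z _.
by rewrite !ev2_tens mulrACA.
Qed.

(** * Preservation of units *)

(** Both sides vanish unless [k = 1]; then [h ▷ 1 = 1], and the Kronecker delta becomes the
    condition [v = 1]. *)
Lemma coproduct_one : coproduct (conv_one H K F) = tens_one A A.
Proof.
apply: ev2_inj => u v h k uv hk.
have [uH vK _ _ _] := OmegaP gH gK tHK uv.
have [hH kK _ _ _] := OmegaP gH gK tHK hk.
rewrite coproductE // ev2_tens /= (conv_oneE _ uv) (conv_oneE _ hk).
have [k1|k1] := eqVneq k 1%g.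
  rewrite k1 lact1 // conv_oneE ?eqxx ?mul1r ?mulr1 1?eq_sym //.
  by apply: Omega1r => //; exact: group_closedM.
rewrite mulr0; have [hkv|_] := eqVneq (h ▷ k) v; last by rewrite mulr0.
rewrite conv_oneE ?(negPf k1) ?mul0r //.
by apply: (Omega_cop gH gK tHK _ hk); rewrite hkv.
Qed.

Lemma coproduct_hat_one : coproduct_hat (conv_hat_one H K F) = tens_one A' A'.
Proof.
apply: ev2_inj => u v h k uv hk.
have [uH vK _ _ _] := OmegaP gH gK tHK uv.
have [hH kK _ _ _] := OmegaP gH gK tHK hk.
rewrite coproduct_hatE // ev2_tens /= (conv_hat_oneE _ uv) (conv_hat_oneE _ hk).
have [u1|u1] := eqVneq u 1%g.
  rewrite u1 ract1l // conv_hat_oneE ?eqxx ?mul1r 1?eq_sym //.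
  by apply: Omega1l => //; exact: group_closedM.
rewrite mul0r; have [uvh|_] := eqVneq (u ◁ v) h; last by rewrite mulr0.
rewrite conv_hat_oneE ?(negPf u1) ?mul0r //.
by apply: (Omega_coph gH gK tHK uv); rewrite uvh.
Qed.

(** * Multiplicativity when HK = KH *)

Lemma Omega_full : fset_mulg H K = fset_mulg K H ->
  forall h k, h \in H -> k \in K -> (h, k) \in Omega.
Proof.
move=> HK h k hH kK; rewrite OmegaE hH kK -HK.
by apply/fset_mulgP; exists h, k.
Qed.

(** For fixed [l], the delta in [coproduct f] leaves only [w = h ▷ l] in the double sum. The delta
    in [coproduct g] then reduces to the one on the left, and the sums over [l] agree term by
    term. *)
Lemma coproductM : fset_mulg H K = fset_mulg K H -> forall f g : fOmega,
  coproduct (conv f g) = tens_mul A A (coproduct f) (coproduct g).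
Proof.
move=> HK f g; have full := Omega_full HK.
apply: ev2_inj => u v h k uv hk; rewrite coproductE // tens_conv_evE //.
have [uH vK _ _ _] := OmegaP gH gK tHK uv.
have [hH kK _ _ _] := OmegaP gH gK tHK hk.
have uhH : (u * h)%g \in H by exact: group_closedM.
rewrite conv_evE ?full // mulr_suml exchange_big /=.
rewrite [LHS]big_seq_cond [RHS]big_seq_cond.
apply: eq_big => [l|l /andP[lK _]].
  by case lK: (l \in K); rewrite //= !full.
have hl := full _ _ hH lK; have [_ _ aK bH e] := OmegaP gH gK tHK hl.
have ua := full _ _ uH aK; have [_ _ cK dH e'] := OmegaP gH gK tHK ua.
(* Moving [l] past [h] and then past [u] factors [uhl] in KH; uniqueness of the factorization gives
   both identities. *)
have [_ ->] : (u * h)%g ▷ l = u ▷ (h ▷ l) /\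
              (u * h)%g ◁ l = ((u ◁ (h ▷ l)) * (h ◁ l))%g.
  apply: (lract_uniq gH gK tHK cK); first exact: group_closedM.
  by rewrite mulgA -e' -!mulgA e.
have [hlk _ hlkE] := Omega_conv gH gK tHK hl hk.
rewrite big_mkcond (big_fsetD1 (h ▷ l)) //= ua.
have [o _ _] := Omega_conv gH gK tHK ua uv.
(* The second delta compares [(h ▷ l)^-1 (h ▷ k)] with [(h ▷ l)^-1 v]; cancelling leaves
   [h ▷ k = v]. *)
rewrite !coproductE // hlkE eqxx mulr1 (inj_eq (mulgI _)) mulrA.
rewrite big_seq big1 ?addr0 // => w /fsetD1P[/negPf wa wK].
case: ifP => // uw; rewrite coproductE // eq_sym wa.
by rewrite mulr0 mul0r.
Qed.

(** Here the second factor does the selecting: for fixed [w], the delta in [coproduct_hat g] leaves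
    only [z = w ◁ v]. *)
Lemma coproduct_hatM : fset_mulg H K = fset_mulg K H -> forall f g : fOmega,
  coproduct_hat (conv_hat f g) =
  tens_mul A' A' (coproduct_hat f) (coproduct_hat g).
Proof.
move=> HK f g; have full := Omega_full HK.
apply: ev2_inj => u v h k uv hk; rewrite coproduct_hatE // tens_conv_hat_evE //.
have [uH vK _ _ _] := OmegaP gH gK tHK uv.
have [hH kK _ _ _] := OmegaP gH gK tHK hk.
have vkK : (v * k)%g \in K by exact: group_closedM.
rewrite convh_evE ?full // mulr_suml.
rewrite [LHS]big_seq_cond [RHS]big_seq_cond.
apply: eq_big => [w|w /andP[wH _]].
  by case wH: (w \in H); rewrite //= !full.
have wv := full _ _ wH vK; have [_ _ aK bH e] := OmegaP gH gK tHK wv.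
have bk := full _ _ bH kK; have [_ _ cK dH e'] := OmegaP gH gK tHK bk.
have [-> _] : w ▷ (v * k)%g = ((w ▷ v) * ((w ◁ v) ▷ k))%g /\
              w ◁ (v * k)%g = (w ◁ v) ◁ k.
  apply: (lract_uniq gH gK tHK _ dH); first exact: group_closedM.
  by rewrite mulgA e -!mulgA e'.
have [uwv _ uwvE] := Omega_convh gH gK tHK wv uv.
rewrite big_mkcond (big_fsetD1 (w ◁ v)) //= bk.
have [o _ _] := Omega_convh gH gK tHK bk hk.
rewrite !coproduct_hatE // uwvE eqxx mulr1 (inj_eq (mulIg _)) mulrAC.
rewrite big_seq big1 ?addr0 // => z /fsetD1P[/negPf za zH].
case: ifP => // zk; rewrite [X in _ * X]coproduct_hatE // eq_sym za.
by rewrite !mulr0.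
Qed.

(** * Multiplicativity forces HK = KH *)

Lemma coproductM_full :
    (forall f g : fOmega,
       coproduct (conv f g) = tens_mul A A (coproduct f) (coproduct g)) ->
  forall h l, h \in H -> l \in K -> (h, l) \in Omega.
Proof.
move=> cM h l hH lK; apply: contraT => nhl.
have hV : (h^-1)%g \in H by exact: group_closedV.
have H1 : 1%g \in H by case: gH.
have lV : (l^-1)%g \in K by exact: group_closedV.
have o1 := Omega1l gH lK; have o1V := Omega1l gH lV.
have oh := Omega1r gK hH; have ohV := Omega1r gK hV.
have o11 := Omega1r gK H1.
have evd x (p : Omega) : x \in Omega ->
    ev (delta F p) x.1 x.2 = (val p == x)%:R.
  by case: x => a b ab; rewrite ev_in ffunE -val_eqE.
pose f := delta F ([` o1] : Omega); pose g := delta F ([` o1V] : Omega).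
have := congr1 (fun X => ev2 X h^-1%g 1%g h 1%g) (cM f g).
rewrite coproductE // lact1 // eqxx mulr1 mulVg conv_evE //.
(* The term at [l] is [f(1, l) g(1, l^-1) = 1]; all the others contain [f(1, w) = 0]. *)
rewrite (big_rem l) //= o1 ract1l // mulg1.
rewrite /f /g (evd (_, _)) // (evd (_, _)) // !eqxx mulr1.
rewrite big_seq_cond big1 => [|w /andP[wl ow]]; last first.
  rewrite (evd (_, _)) // xpair_eqE eqxx /= eq_sym.
  move: wl; rewrite rem_filter // mem_filter => /andP[/negPf /= -> _].
  by rewrite mul0r.
(* Each term on the right contains [f(1, w')] with [(h, w')] in Omega. Since [(h, l)] is not in
   Omega, [w'] differs from [l] and the sum is zero, giving [1 = 0]. *)
rewrite tens_conv_evE // addr0 big1 => [/eqP|w uw]; first by rewrite oner_eq0.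
apply: big1 => w' hw'; rewrite coproductE // mulVg (evd (1%g, _)); last first.
  by apply: Omega1l => //; case: (OmegaP gH gK tHK hw').
rewrite xpair_eqE eqxx /=; have [lw|_] := eqVneq l w'; last by rewrite !mul0r.
by rewrite lw hw' in nhl.
Qed.

Lemma fset_mulgC_full :
    (forall h l, h \in H -> l \in K -> (h, l) \in Omega) ->
  fset_mulg H K = fset_mulg K H.
Proof.
move=> full; apply/fsetP => x; apply/fset_mulgP/fset_mulgP.
  case=> a [b [aH bK ->]]; have := full a b aH bK.
  by rewrite OmegaE => /and3P[_ _ /fset_mulgP].
case=> a [b [aK bH ->]].
have aV := group_closedV gK aK; have bV := group_closedV gH bH.
(* The inverse [b^-1 a^-1] of [x] lies in HK, hence equals some [c d] in KH, so that
   [x = d^-1 c^-1]. *)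
have := full _ _ bV aV; rewrite OmegaE => /and3P[_ _ /fset_mulgP].
case=> c [d [cK dH e]]; exists (d^-1)%g, (c^-1)%g.
split; [exact: group_closedV | exact: group_closedV |].
by rewrite -[LHS]invgK -invgM -e invgM.
Qed.

End Coproducts.

Theorem proposition6p7 (R : realType) (G : groupType) (H K : {fset G})
    (gH : group_closed [in H]) (gK : group_closed [in K])
    (tHK : H `&` K = [fset 1%g]) :
  (alg_hom (coproduct (H := H) (K := K) (F := R[i])
      : alg_of (Omega_alg R[i] gH gK tHK) ->
        alg_of (tens_alg (Omega_alg R[i] gH gK tHK)
                         (Omega_alg R[i] gH gK tHK))) /\
   alg_hom (coproduct_hat (H := H) (K := K) (F := R[i])
      : alg_of (Omega_hat_alg R[i] gH gK tHK) ->
        alg_of (tens_alg (Omega_hat_alg R[i] gH gK tHK)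
                         (Omega_hat_alg R[i] gH gK tHK))))
  <-> fset_mulg H K = fset_mulg K H.
Proof.
split=> [[[_ [_ cM]] _]|HK].
  exact: (fset_mulgC_full gH gK (coproductM_full gH gK tHK cM)).
split; split.
- exact: coproduct_linear.
- by split; [exact: coproduct_one | exact: coproductM].
- exact: coproduct_hat_linear.
- by split; [exact: coproduct_hat_one | exact: coproduct_hatM].
Qed.
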